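(* Let $X$ be an $n\times n$ symmetric matrix of indeterminates over $\mathbb{Z}$, $S=\mathbb{Z}[X]$ and $R=S/(\det X)$. \begin{enumerate} \item[(a)] If $n=3$ and $p$ is an odd prime, then the Frobenius endomorphism of $R/pR$ lifts to an endomorphism of $R/p^2R$. \item[(b)] If $n\geqslant3$, then the Frobenius endomorphism of $R/2R$ does not lift to an endomorphism of $R/4R$. \item[(c)] If $n\geqslant4$ and $p$ is an odd prime, then the Frobenius endomorphism of $R/pR$ does not lift to an endomorphism of $R/p^2R$. \end{enumerate}
   Context: A lift of the Frobenius endomorphism of $R/pR$ to $R/p^2R$ is a ring endomorphism $\Lambda$ of $R/p^2R$ with $\Lambda(r)\equiv r^p\pmod p$ for all $r\in R/p^2R$. *)

(* Defs.v *)
From HB Require Import structures.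
From mathcomp Require Import all_boot all_order all_algebra.
From mathcomp Require Import mpoly.
Set Implicit Arguments. Unset Strict Implicit. Unset Printing Implicit Defensive.
Import Order.TTheory GRing.Theory.
Local Open Scope ring_scope.

(* Index set of the independent entries of an n x n symmetric matrix:
   pairs (i, j) with i <= j. *)
Definition symidx (n : nat) := {p : 'I_n * 'I_n | (p.1 <= p.2)%N}.

Definition nvars (n : nat) : nat := #|{: symidx n}|.

Definition Spoly (n : nat) := {mpoly int[nvars n]}.

Definition sortpair n (i j : 'I_n) : 'I_n * 'I_n :=
  if (i <= j)%N then (i, j) else (j, i).

Lemma sortpair_le n (i j : 'I_n) : ((sortpair i j).1 <= (sortpair i j).2)%N.
Proof.
rewrite /sortpair; case: ifP => //= /negbT; rewrite -ltnNge; exact: ltnW.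
Qed.

Definition symvar n (i j : 'I_n) : 'I_(nvars n) :=
  enum_rank (exist (fun p : 'I_n * 'I_n => (p.1 <= p.2)%N) (sortpair i j)
                   (sortpair_le i j)).

Definition Xsym (n : nat) : 'M[Spoly n]_n :=
  \matrix_(i < n, j < n) 'X_(symvar i j).

Definition detX (n : nat) : Spoly n := \det (Xsym n).

Definition eqmod (n q : nat) (a b : Spoly n) : Prop :=
  exists g h : Spoly n, a - b = detX n * g + q%:R * h.

(* R = S/(det X).  A lift of the Frobenius of R/pR to R/p^2R:
   a ring endomorphism Lambda of R/p^2R = S/(det X, p^2) (represented by a map
   S -> S that is well defined and a unital ring morphism modulo (det X, p^2))
   such that Lambda(r) == r^p mod p, i.e. modulo (det X, p^2, p) = (det X, p). *)
Definition frobenius_lifts (n p : nat) : Prop :=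
  exists L : Spoly n -> Spoly n,
    [/\ (forall a b, eqmod (p ^ 2)%N a b -> eqmod (p ^ 2)%N (L a) (L b)),
        (forall a b, eqmod (p ^ 2)%N (L (a + b)) (L a + L b)),
        (forall a b, eqmod (p ^ 2)%N (L (a * b)) (L a * L b)),
        eqmod (p ^ 2)%N (L 1) 1
      & (forall r, eqmod p (L r) (r ^+ p))].

(* Main.v *)
(** (a) On rank-two symmetric matrices [x_ij = (y_i z_j + y_j z_i) / 2] the
    substitution [y_i -> y_i^p, z_i -> z_i^p] preserves the invariants [x_ij]:
    it maps [x_ij] to the homogenized Chebyshev polynomial
    [T_p (x_ij, x_ii x_jj)], which has integer coefficients and is congruent to
    [x_ij^p] modulo the odd prime [p].  For [n = 3] this substitution maps
    [det X] to a multiple of itself.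

    (b), (c) Given a lift, every specialization of [X] to a symmetric matrix [M]
    with zero determinant over a ring where [p^2 = 0] provides a symmetric [H],
    specialized from [Z[X]], with [det (M^(p) + p H) = 0], the power being
    entrywise.  The last [n - k] rows and columns of [M] are those of the
    identity matrix; the upper left block is [(l_i l_j m_ij)], with [k = 3] for
    (b) and [k = 4] for (c), where the [l_i] are indeterminates and
    [m_ij] are polynomials in [s].  In the coefficient of [prod_i l_i^(2p)] the
    multigrading leaves from each [H_ij] that matters only a constant multiple
    of [m_ij^p], which modulo [p] is a polynomial in [s^p]; but [det M^(p)]
    contributes other powers of [s]. *)

Require Import Defs.
From HB Require Import structures.
From mathcomp Require Import all_boot all_order all_algebra.
From mathcomp Require Import mpoly ring zify.
Set Implicit Arguments. Unset Strict Implicit. Unset Printing Implicit Defensive.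
Import GRing.Theory.
Local Open Scope ring_scope.

(** * Chebyshev polynomials *)

(** [A] is [S[T]/(T^2 - eT + q)] and [al] is the class of [T], so [i e - al] is the other root. The
    constant coefficient [l] is an [S]-linear retraction of [i], through which identities in [A]
    descend to [S]. *)
Lemma quadratic_extension (S : comNzRingType) (e q : S) :
  exists (A : comNzRingType) (i : {rmorphism S -> A}) (l : A -> S) (al : A),
    [/\ forall s a, l (i s * a) = s * l a, l 1 = 1
      & al * (i e - al) = i q].
Proof.
pose h : {poly S} := 'X^2 - e *: 'X + q%:P.
have sz2 : (size (- (e *: 'X) + q%:P : {poly S})%R < size ('X^2 : {poly S})%R)%N.
  rewrite size_polyXn ltnS (leq_trans (size_polyD _ _)) // geq_max size_polyN.
  rewrite (leq_trans (size_scale_leq _ _)) ?size_polyX //.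
  by rewrite size_polyC; case: (_ != _).
have szh : size h = 3%N by rewrite /h -addrA size_polyDl // size_polyXn.
have hmon : h \is monic.
  by rewrite monicE /h -addrA lead_coefDl // lead_coefXn.
have mkh : mk_monic h = h by rewrite /mk_monic szh hmon.
exists {poly %/ h}, (qpolyC h), (fun a : {poly %/ h} => (a : {poly S})`_0), ('qX : {poly %/ h}).
split.
- move=> s a; rewrite poly_of_qpolyM Pdiv.Ring.rmodp_small.
    by rewrite qpolyCE coefCM.
  rewrite qpolyCE mul_polyC (leq_ltn_trans (size_scale_leq _ _)) //.
  exact: size_mk_monic.
- by rewrite -[(1 : {poly %/ h})]/(qpolyC h 1) qpolyCE coefC.
have inC (s : S) : qpolyC h s = in_qpoly h s%:P.
  apply: val_inj; rewrite /= Pdiv.Ring.rmodp_small // mkh szh.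
  by rewrite size_polyC; case: (_ != _).
rewrite /= !inC -[qpolyX h]/(in_qpoly h 'X) -rmorphB -rmorphM.
have -> : 'X * (e%:P - 'X) = q%:P - h :> {poly S}.
  by rewrite /h -mul_polyC; ring.
rewrite rmorphB /=; have -> : in_qpoly h h = 0; last by rewrite subr0.
by apply: val_inj; rewrite /= mkh Pdiv.RingMonic.rmodpp.
Qed.

(* The homogenized Chebyshev polynomial of the first kind: with
   [x = (al + be) / 2] and [y = al * be] it is [(al ^ k + be ^ k) / 2]. *)
Fixpoint cheb2 (S : pzRingType) (k : nat) (x y : S) : S * S :=
  if k is k'.+1 then let: (u, v) := cheb2 k' x y in (v, 2%:R * x * v - y * u)
  else (1, x).

Definition cheb (S : pzRingType) k (x y : S) : S := (cheb2 k x y).1.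

Section Chebyshev.
Implicit Type S : comNzRingType.

Lemma chebSS S k (x y : S) :
  cheb k.+2 x y = 2%:R * x * cheb k.+1 x y - y * cheb k x y.
Proof. by rewrite /cheb /=; case: (cheb2 k x y). Qed.

Lemma two_step_ind (P : nat -> Prop) :
  P 0%N -> P 1%N -> (forall k, P k -> P k.+1 -> P k.+2) -> forall k, P k.
Proof.
move=> P0 P1 PSS k; suff [] : P k /\ P k.+1 by [].
by elim: k => [|k []]; auto.
Qed.

Lemma rmorph_cheb S (A : comNzRingType) (i : {rmorphism S -> A}) k x y :
  i (cheb k x y) = cheb k (i x) (i y).
Proof.
elim/two_step_ind: k => [||k IH0 IH1]; [exact: rmorph1 | by [] |].
by rewrite !chebSS rmorphB !rmorphM IH0 IH1 rmorph_nat.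
Qed.

Lemma cheb_powersum S k (x al be : S) : al + be = 2%:R * x ->
  2%:R * cheb k x (al * be) = al ^+ k + be ^+ k.
Proof.
move=> sE; elim/two_step_ind: k => [||k IH0 IH1]; rewrite ?chebSS.
- by rewrite /cheb /= !expr0; ring.
- by rewrite /cheb /= !expr1.
rewrite mulrBr mulrCA IH1 [2%:R * (_ * cheb k _ _)]mulrCA IH0 -sE !exprS; ring.
Qed.

Lemma chebZ S k (b x y : S) : cheb k (b * x) (b ^+ 2 * y) = b ^+ k * cheb k x y.
Proof.
elim/two_step_ind: k => [||k IH0 IH1]; rewrite ?chebSS.
- by rewrite /cheb /= expr0 mulr1.
- by rewrite /cheb /= expr1.
by rewrite IH0 IH1 !exprS; ring.
Qed.

(** The case of a double root. It makes the lift act on the diagonal variables as the [p]-th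
    power. *)
Lemma cheb_sqr S k (x : S) : cheb k x (x ^+ 2) = x ^+ k.
Proof.
elim/two_step_ind: k => [||k IH0 IH1]; rewrite ?chebSS //.
by rewrite IH0 IH1 !exprS; ring.
Qed.

(** By [cheb_powersum] the left side vanishes once [2x = al + be]; without that hypothesis it is a
    multiple of the defect, and the recursion yields the quotient. *)
Lemma cheb_powersum_dvd S k (x al be : S) :
  exists e, 2%:R * cheb k x (al * be) - (al ^+ k + be ^+ k)
            = (2%:R * x - (al + be)) * e.
Proof.
elim/two_step_ind: k => [||k [e0 IH0] [e1 IH1]]; rewrite ?chebSS.
- by exists 0; rewrite /cheb /= !expr0; ring.
- by exists 1; rewrite /cheb /= !expr1 mulr1.
exists (al ^+ k.+1 + be ^+ k.+1 + 2%:R * x * e1 - al * be * e0).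
have -> : 2%:R * (2%:R * x * cheb k.+1 x (al * be) - al * be * cheb k x (al * be))
   = 2%:R * x * (2%:R * cheb k.+1 x (al * be) - (al ^+ k.+1 + be ^+ k.+1))
     - al * be * (2%:R * cheb k x (al * be) - (al ^+ k + be ^+ k))
     + 2%:R * x * (al ^+ k.+1 + be ^+ k.+1) - al * be * (al ^+ k + be ^+ k).
  by ring.
by rewrite IH0 IH1 !exprS; ring.
Qed.

Lemma exprD_prime S p (x y : S) : prime p ->
  exists w, (x + y) ^+ p = x ^+ p + y ^+ p + p%:R * w.
Proof.
move=> p_pr; have p_gt0 := prime_gt0 p_pr.
rewrite exprDn -(prednK p_gt0) big_ord_recl big_ord_recr /= prednK //.
rewrite !subn0 /bump /= add1n prednK // subnn bin0 binn !expr0 !mulr1n mulr1 mul1r.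
exists (\sum_(i < p.-1) x ^+ (p - i.+1) * y ^+ i.+1 *+ ('C(p, i.+1) %/ p)).
rewrite addrAC -addrA; congr (_ + (_ + _)).
rewrite mulr_sumr; apply: eq_bigr => i _; rewrite /bump /= add1n.
rewrite mulr_natl -mulrnA divnK // prime_dvd_bin //=.
by case: i => i /=; lia.
Qed.

(** Let [al], [be] be the roots of [T^2 - 2xT + y]. Modulo [p], [2 cheb p x y = al^p + be^p] is
    [(al + be)^p = 2^p x^p], hence [2 x^p], and 2 is invertible modulo the odd [p]. *)
Lemma cheb_frobenius S p (x y : S) : prime p -> odd p ->
  exists w, cheb p x y - x ^+ p = p%:R * w.
Proof.
move=> p_pr p_odd.
have [A [i [l [al [l_lin l1 alE]]]]] := quadratic_extension (2%:R * x) y.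
have [w1 w1E] := exprD_prime al (i (2%:R * x) - al) p_pr.
have w1S : (2%:R * x) ^+ p - 2%:R * cheb p x y = p%:R * l w1.
  rewrite -[LHS]mulr1 -[X in _ * X = _]l1 -!l_lin mulr1; congr (l _).
  rewrite rmorphB rmorphM !rmorph_nat rmorph_cheb rmorphXn -alE.
  rewrite (@cheb_powersum _ _ _ al (i (2%:R * x) - al)); last first.
    by rewrite rmorphM rmorph_nat; ring.
  by move: w1E; rewrite [al + _]addrC subrK => ->; ring.
have [w2 w2E] : exists w2 : S, 2%:R ^+ p = 2%:R + p%:R * w2.
  have [w wE] := exprD_prime (1 : S) 1 p_pr; exists w.
  by rewrite !expr1n in wE.
(* Modulo [p] the inverse of 2 is [-(p./2)]. *)
have half : 1 = p%:R - 2%:R * (p./2)%:R :> S.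
  by rewrite -natrM -{1}[p]odd_double_half p_odd natrD -mul2n addrK.
exists (cheb p x y - x ^+ p - (p./2)%:R * (w2 * x ^+ p - l w1)).
have {}w1S : 2%:R * (cheb p x y - x ^+ p) = p%:R * (w2 * x ^+ p - l w1).
  by rewrite [RHS]mulrBr -w1S exprMn w2E; ring.
rewrite -[LHS]mul1r {1}half mulrBl [X in _ - X]mulrAC w1S.
by ring.
Qed.

(** The discriminant of the ternary form [aX^2 + bY^2 + cZ^2 + 2fYZ + 2gXZ + 2hXY]. *)
Definition sdet3 S (a b c f g h : S) : S :=
  a * b * c + 2%:R * f * g * h - a * f ^+ 2 - b * g ^+ 2 - c * h ^+ 2.

(* Adjoin roots [al, be] of [T^2 - 2fT + bc] and [ga, de] of [T^2 - 2hT + ab].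
   With [t = al ga + be de] and [t' = al de + be ga] one has
   [(2bg - t)(2bg - t') = - 4b * sdet3], and raising [al, be, ga, de] to the
   [k]-th power turns each factor into a multiple of itself. *)
Lemma sdet3_cheb_dvd S k (a b c f g h : S) :
  exists w, 4%:R * b ^+ k *
    sdet3 (a ^+ k) (b ^+ k) (c ^+ k)
          (cheb k f (b * c)) (cheb k g (a * c)) (cheb k h (a * b))
    = 4%:R * b * sdet3 a b c f g h * w.
Proof.
have [A [i [l [al0 [l_lin l1 alE0]]]]] := quadratic_extension (2%:R * f) (b * c).
have [B [j [m [ga [m_lin m1 gaE]]]]] :=
  quadratic_extension (i (2%:R * h)) (i (a * b)).
pose ij : {rmorphism S -> B} := (j \o i)%FUN.
pose al := j al0; pose be := ij (2%:R * f) - al; pose de := ij (2%:R * h) - ga.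
have alE : al * be = ij b * ij c.
  by rewrite -rmorphM /= -alE0 rmorphM rmorphB.
have {}gaE : ga * de = ij a * ij b by rewrite -rmorphM.
have albe : al + be = 2%:R * ij f.
  by rewrite /be rmorphM rmorph_nat; ring.
have gade : ga + de = 2%:R * ij h.
  by rewrite /de rmorphM rmorph_nat; ring.
have sdetE (a' b' c' f' g' h' al' be' ga' de' : B) :
    al' * be' = b' * c' -> ga' * de' = a' * b' ->
    al' + be' = 2%:R * f' -> ga' + de' = 2%:R * h' ->
    - (4%:R * b' * sdet3 a' b' c' f' g' h') =
    (2%:R * (b' * g') - (al' * ga' + be' * de')) *
    (2%:R * (b' * g') - (al' * de' + be' * ga')).
  move=> e1 e2 e3 e4; rewrite /sdet3.
  (* Exchanging the members of either pair swaps the two factors, so their product is a polynomial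
     in the sums and products of the pairs. *)
  have -> : (2%:R * (b' * g') - (al' * ga' + be' * de')) *
            (2%:R * (b' * g') - (al' * de' + be' * ga'))
    = 4%:R * b' ^+ 2 * g' ^+ 2 - 2%:R * b' * g' * (al' + be') * (ga' + de')
      + ((al' + be') ^+ 2 - 2%:R * (al' * be')) * (ga' * de')
      + (al' * be') * ((ga' + de') ^+ 2 - 2%:R * (ga' * de')) by ring.
  by rewrite e1 e2 e3 e4; ring.
(* [e1] and [e2] are the quotients of the two factors built from [k]-th powers by the original ones.
   Both root products equal [a b^2 c], and homogeneity pulls [b^k] out of the Chebyshev
   polynomial. *)
have [e1 e1E] := cheb_powersum_dvd k (ij b * ij g) (al * ga) (be * de).
have [e2 e2E] := cheb_powersum_dvd k (ij b * ij g) (al * de) (be * ga).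
have chebbg x y : x * y = ij a * ij b ^+ 2 * ij c ->
    cheb k (ij b * ij g) (x * y) = ij b ^+ k * cheb k (ij g) (ij a * ij c).
  by move=> ->; rewrite -chebZ; congr (cheb k _ _); ring.
exists (l (m (e1 * e2))).
have {}l_lin s x : l (m (ij s * x)) = s * l (m x) by rewrite m_lin l_lin.
have lm1 : l (m 1) = 1 by rewrite m1.
rewrite -[LHS]mulr1 -[X in _ * X = _]lm1 -!l_lin mulr1.
congr (l (m _)).
have sdetM (x1 x2 x3 x4 x5 x6 : S) : ij (sdet3 x1 x2 x3 x4 x5 x6) =
   sdet3 (ij x1) (ij x2) (ij x3) (ij x4) (ij x5) (ij x6).
  by rewrite /sdet3 !(rmorphB, rmorphD, rmorphM, rmorph1).
rewrite !rmorphM !sdetM !rmorphXn !rmorph_cheb !rmorphM !rmorph_nat.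
apply: oppr_inj; rewrite -[RHS]mulNr.
rewrite (sdetE _ _ _ _ _ _ _ _ _ _ alE gaE albe gade).
rewrite (sdetE _ _ _ _ _ _ (al ^+ k) (be ^+ k) (ga ^+ k) (de ^+ k)); last 4 first.
- by rewrite -!exprMn alE.
- by rewrite -!exprMn gaE.
- by rewrite -alE (cheb_powersum _ albe).
- by rewrite -gaE (cheb_powersum _ gade).
rewrite -(chebbg (al * ga) (be * de)); last first.
  by rewrite mulrACA alE gaE; ring.
rewrite -!exprMn e1E (_ : al * ga * (be * de) = al * de * (be * ga)); last ring.
by rewrite e2E; ring.
Qed.

End Chebyshev.

(** * Integer polynomials and cancellation of a variable *)

Section PolyInt.
Variable N : nat.
Implicit Types (P Q : {mpoly int[N]}).

(** Integer constants arise from 1 by subtraction, so the variables generate everything as a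
    ring. *)
Lemma mpoly_closed_ind (K : {mpoly int[N]} -> Prop) :
    K 1 -> (forall v, K 'X_v) -> (forall P Q, K P -> K Q -> K (P - Q)) ->
    (forall P Q, K P -> K Q -> K (P * Q)) ->
  forall P, K P.
Proof.
move=> K1 KX KB KM.
have K0 : K 0 by rewrite -(subrr 1); exact: KB.
have KN P : K P -> K (- P) by rewrite -sub0r; exact: KB.
have KD P Q : K P -> K Q -> K (P + Q).
  by move=> KP KQ; rewrite -[Q]opprK; apply/KB/KN.
have KE P k : K P -> K (P ^+ k).
  by move=> KP; elim: k => // k IH; rewrite exprS; exact: KM.
have Knat k : K k%:R by elim: k => // k IH; rewrite -natr1; exact: KD.
have Kint (c : int) : K c%:MP.
  rewrite -[c]intz rmorph_int; case: c => k; first exact: Knat.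
  by rewrite NegzE rmorphN; exact/KN/Knat.
elim/mpolyind => // c m P _ _ KP; apply: KD => //.
rewrite -mul_mpolyC; apply: (KM) => //; rewrite mpolyXE_id.
by apply: (big_ind K) => [//|P1 P2|i _]; [exact: KM | exact: KE].
Qed.

Definition zero_var (v : 'I_N) : {mpoly int[N]} -> {mpoly int[N]} :=
  mmap intr (fun i => if i == v then 0 else 'X_i).

HB.instance Definition _ v := GRing.RMorphism.on (zero_var v).

Lemma zero_varX v i : zero_var v 'X_i = if i == v then 0 else 'X_i.
Proof. by rewrite /zero_var mmapX mmap1U. Qed.

Lemma zero_var_mod v P : exists Q, P - zero_var v P = 'X_v * Q.
Proof.
elim/mpoly_closed_ind: P => [|i|P Q [P' PE] [Q' QE]|P Q [P' PE] [Q' QE]].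
- by exists 0; rewrite rmorph1; ring.
- rewrite zero_varX; case: eqP => [->|_]; first by exists 1; ring.
  by exists 0; ring.
- exists (P' - Q'); rewrite mulrBr -PE -QE rmorphB /=; ring.
exists (P' * Q + zero_var v P * Q'); rewrite mulrDr mulrA -PE mulrCA -QE.
by rewrite rmorphM /=; ring.
Qed.

(** ['X_v] is prime and does not divide [P], so it divides [W]; one factor ['X_v] is cancelled at a
    time. *)
Lemma mulX_dvd_cancel v k P Q W :
  zero_var v P != 0 -> 'X_v ^+ k * Q = P * W -> exists W', Q = P * W'.
Proof.
move=> Pnz; elim: k W => [|k IH] W; first by rewrite mul1r; exists W.
rewrite exprS -mulrA => E.
have zW : zero_var v W = 0.
  have /eqP := congr1 (zero_var v) E.
  rewrite !rmorphM /= zero_varX eqxx mul0r eq_sym mulf_eq0 (negPf Pnz) /=.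
  by move/eqP.
have [W' W'E] := zero_var_mod v W; rewrite zW subr0 in W'E.
apply: (IH W'); apply: (@mulfI _ 'X_v); first by rewrite -msize_poly_eq0 msizeX.
by rewrite E W'E; ring.
Qed.

End PolyInt.

(** * Explicit determinants *)

Lemma det_matrix2 (R : comNzRingType) (F : nat -> nat -> R) :
  \det (\matrix_(i < 2, j < 2) F i j) = F 0 0 * F 1 1 - F 0 1 * F 1 0.
Proof.
rewrite (expand_det_row _ ord0) !big_ord_recl big_ord0 /cofactor !det_mx11 !mxE /=.
by rewrite /bump /= ?addn0 ?add1n expr0 expr1; ring.
Qed.

(** With entries given by a function on [nat], a minor has the same shape with shifted indices, so
    the Laplace expansion can be iterated. *)
Lemma minor_matrix (R : comNzRingType) n (F : nat -> nat -> R) (j : 'I_n.+1) :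
  row' ord0 (col' j (\matrix_(i < n.+1, k < n.+1) F i k)) =
  \matrix_(i < n, k < n) F i.+1 (bump j k).
Proof. by apply/matrixP => i k; rewrite !mxE. Qed.

Lemma det_matrix3 (R : comNzRingType) (F : nat -> nat -> R) :
  \det (\matrix_(i < 3, j < 3) F i j) =
    F 0 0 * (F 1 1 * F 2 2 - F 1 2 * F 2 1)
  - F 0 1 * (F 1 0 * F 2 2 - F 1 2 * F 2 0)
  + F 0 2 * (F 1 0 * F 2 1 - F 1 1 * F 2 0).
Proof.
rewrite (expand_det_row _ ord0) !big_ord_recl big_ord0 /cofactor !minor_matrix.
rewrite !(det_matrix2 (fun i k => F i.+1 (bump _ k))) !mxE /= /bump /=.
by ring.
Qed.

Lemma det_matrix4 (R : comNzRingType) (F : nat -> nat -> R) :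
  \det (\matrix_(i < 4, j < 4) F i j) =
    F 0 0 * (F 1 1 * (F 2 2 * F 3 3 - F 2 3 * F 3 2)
            - F 1 2 * (F 2 1 * F 3 3 - F 2 3 * F 3 1)
            + F 1 3 * (F 2 1 * F 3 2 - F 2 2 * F 3 1))
  - F 0 1 * (F 1 0 * (F 2 2 * F 3 3 - F 2 3 * F 3 2)
            - F 1 2 * (F 2 0 * F 3 3 - F 2 3 * F 3 0)
            + F 1 3 * (F 2 0 * F 3 2 - F 2 2 * F 3 0))
  + F 0 2 * (F 1 0 * (F 2 1 * F 3 3 - F 2 3 * F 3 1)
            - F 1 1 * (F 2 0 * F 3 3 - F 2 3 * F 3 0)
            + F 1 3 * (F 2 0 * F 3 1 - F 2 1 * F 3 0))
  - F 0 3 * (F 1 0 * (F 2 1 * F 3 2 - F 2 2 * F 3 1)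
            - F 1 1 * (F 2 0 * F 3 2 - F 2 2 * F 3 0)
            + F 1 2 * (F 2 0 * F 3 1 - F 2 1 * F 3 0)).
Proof.
rewrite (expand_det_row _ ord0) !big_ord_recl big_ord0 /cofactor !minor_matrix.
rewrite !(det_matrix3 (fun i k => F i.+1 (bump _ k))) !mxE /= /bump /=.
by ring.
Qed.

(** * The lift for 3 x 3 matrices *)

Lemma sortpairC n (i j : 'I_n) : sortpair i j = sortpair j i.
Proof.
rewrite /sortpair; case: (ltngtP i j) => // ij.
by rewrite (val_inj ij).
Qed.

Lemma symvarC n (i j : 'I_n) : symvar i j = symvar j i.
Proof.
by rewrite /symvar; congr enum_rank; apply: val_inj; rewrite /= sortpairC.
Qed.

Lemma val_enum_symvar n (i j : 'I_n) : val (enum_val (symvar i j)) = sortpair i j.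
Proof. by rewrite enum_rankK. Qed.

Lemma symvar_surj n (v : 'I_(nvars n)) : exists i j, v = symvar i j.
Proof.
case E : (enum_val v) => [[i j] /= le_ij]; exists i, j.
rewrite -[v]enum_valK E /symvar; congr enum_rank; apply: val_inj => /=.
by rewrite /sortpair le_ij.
Qed.

Lemma symvar_inj n (i j k l : 'I_n) :
  symvar i j = symvar k l -> (i, j) = (k, l) \/ (i, j) = (l, k).
Proof.
move/(congr1 (fun v => val (enum_val v))); rewrite !val_enum_symvar.
rewrite /sortpair; case: ifP; case: ifP => _ _ [-> ->]; by [left | right].
Qed.

Lemma symvar_inord_eq n i j k l :
  (i <= n)%N -> (j <= n)%N -> (k <= n)%N -> (l <= n)%N ->
  (symvar (inord i) (inord j) == symvar (inord k) (inord l) :> 'I_(nvars n.+1)) =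
  ((i == k) && (j == l)) || ((i == l) && (j == k)).
Proof.
move=> lei lej lek lel; apply/eqP/orP; last first.
  by case=> /andP [/eqP-> /eqP->] //; rewrite symvarC.
by case/symvar_inj=> -[/(congr1 val) /= + /(congr1 val) /=];
   rewrite !inordK // => -> ->; rewrite !eqxx; [left|right].
Qed.

Lemma det_sym3 (R : comNzRingType) (F : nat -> nat -> R) :
  (forall i j, F i j = F j i) ->
  \det (\matrix_(i < 3, j < 3) F i j) =
  sdet3 (F 0 0) (F 1 1) (F 2 2) (F 1 2) (F 0 2) (F 0 1).
Proof.
move=> Fsym; rewrite det_matrix3 (Fsym 1 0) (Fsym 2 0) (Fsym 2 1) /sdet3.
by ring.
Qed.

Definition symX n (i j : nat) : Spoly n.+1 := 'X_(symvar (inord i) (inord j)).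

Lemma symXC n i j : symX n i j = symX n j i.
Proof. by rewrite /symX symvarC. Qed.

Lemma XsymE n : Xsym n.+1 = \matrix_(i < n.+1, j < n.+1) symX n i j.
Proof. by apply/matrixP => i j; rewrite !mxE /symX !inord_val. Qed.

Definition cheb_lift n (p : nat) : Spoly n -> Spoly n :=
  mmap intr (fun v => let: (i, j) := val (enum_val v) in
    cheb p 'X_v ('X_(symvar i i) * 'X_(symvar j j))).

HB.instance Definition _ n p := GRing.RMorphism.on (@cheb_lift n p).

Lemma cheb_liftX n p (i j : 'I_n) :
  cheb_lift p 'X_(symvar i j) =
  cheb p 'X_(symvar i j) ('X_(symvar i i) * 'X_(symvar j j)).
Proof.
rewrite /cheb_lift mmapX mmap1U val_enum_symvar /sortpair.
by case: ifP => // _; rewrite [X in cheb _ _ X]mulrC.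
Qed.

(** Modulo [p] both maps respect differences and products, so agreement on the variables suffices,
    and that is [cheb_frobenius]. *)
Lemma cheb_lift_frobenius n p (r : Spoly n) : prime p -> odd p ->
  exists w, cheb_lift p r - r ^+ p = p%:R * w.
Proof.
move=> p_pr p_odd.
elim/mpoly_closed_ind: r => [|v|P Q [P' PE] [Q' QE]|P Q [P' PE] [Q' QE]].
- by exists 0; rewrite rmorph1 expr1n; ring.
- have [i [j ->]] := symvar_surj v; rewrite cheb_liftX.
  exact: cheb_frobenius.
- have [w wE] := exprD_prime P (- Q) p_pr.
  exists (P' - Q' - w); rewrite wE exprNn -signr_odd p_odd rmorphB /=.
  by rewrite !mulrBr -PE -QE; ring.
exists (P' * cheb_lift p Q + P ^+ p * Q').
by rewrite rmorphM mulrDr mulrA -PE mulrCA -QE exprMn /=; ring.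
Qed.

(** [sdet3_cheb_dvd] gives the divisibility up to a factor [4 x_11^p]. The 4 cancels in a domain,
    and the power of [x_11] cancels because [x_11] does not divide [detX 3]. *)
Lemma cheb_lift_det p : exists w, cheb_lift p (detX 3) = detX 3 * w.
Proof.
pose x i j := symX 2 i j.
have detE : detX 3 = sdet3 (x 0 0) (x 1 1) (x 2 2) (x 1 2) (x 0 2) (x 0 1).
  by rewrite /detX XsymE det_sym3 //; exact: symXC.
have liftE i j : cheb_lift p (x i j) = cheb p (x i j) (x i i * x j j).
  exact: cheb_liftX.
have liftd i : cheb_lift p (x i i) = x i i ^+ p.
  by rewrite liftE -expr2 cheb_sqr.
have [w wE] := sdet3_cheb_dvd p (x 0 0) (x 1 1) (x 2 2) (x 1 2) (x 0 2) (x 0 1).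
have detL : cheb_lift p (detX 3) =
    sdet3 (x 0 0 ^+ p) (x 1 1 ^+ p) (x 2 2 ^+ p)
      (cheb p (x 1 2) (x 1 1 * x 2 2)) (cheb p (x 0 2) (x 0 0 * x 2 2))
      (cheb p (x 0 1) (x 0 0 * x 1 1)).
  by rewrite -!liftd -!liftE detE /sdet3 !(rmorphB, rmorphD, rmorphM, rmorph1).
rewrite -detE -detL in wE.
have {}wE : x 1 1 ^+ p * cheb_lift p (detX 3) = detX 3 * (x 1 1 * w).
  apply: (@mulfI _ (4%:R : Spoly 3)).
    by rewrite -(rmorph_nat (@mpolyC _ _)) mpolyC_eq0.
  by rewrite [LHS]mulrA; apply: etrans wE _; ring.
apply: mulX_dvd_cancel wE.
(* With zero diagonal and all other entries 1 the determinant is 2, so it is nonzero after setting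
   [x_11] to 0. *)
pose ev : {rmorphism Spoly 3 -> int} := meval (fun v => if v \in [:: symvar (inord 1) (inord 2);
  symvar (inord 0) (inord 2); symvar (inord 0) (inord 1) : 'I_(nvars 3)]
  then 1 : int else 0).
have evX v : ev 'X_v = if v \in [:: symvar (inord 1) (inord 2);
    symvar (inord 0) (inord 2); symvar (inord 0) (inord 1)] then 1 else 0.
  exact: mevalXU.
apply/eqP => /(congr1 ev).
rewrite detE /sdet3 !(rmorphB, rmorphD, rmorphM, rmorph1, rmorph0) /= /x /symX.
rewrite !zero_varX !symvar_inord_eq //=.
rewrite !(rmorphB, rmorphD, rmorphM, rmorph1, rmorph0) !evX !inE.
by rewrite !symvar_inord_eq.
Qed.

Lemma frobenius_lifts3 p : prime p -> odd p -> frobenius_lifts 3 p.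
Proof.
move=> p_pr p_odd; exists (cheb_lift p).
have eqmod_refl q (a : Spoly 3) : eqmod q a a.
  by exists 0, 0; rewrite subrr !mulr0 addr0.
split=> [a b [g [h abE]]|a b|a b||r].
- have [w wE] := cheb_lift_det p.
  exists (w * cheb_lift p g), (cheb_lift p h).
  by rewrite -rmorphB abE rmorphD !rmorphM rmorph_nat /= wE mulrA.
- by rewrite rmorphD.
- by rewrite rmorphM.
- by rewrite rmorph1.
have [w wE] := cheb_lift_frobenius r p_pr p_odd.
by exists 0, w; rewrite mulr0 add0r.
Qed.

(** * Specializing a lift *)

(** [L] is a morphism only modulo [(det X, p^2)], but [th] kills this ideal, so [th \o L] is a
    genuine ring morphism. It kills [detX n], and the Frobenius congruence gives its values on the
    variables. *)
Lemma lift_specialize n p (B : comNzRingType) (th : {rmorphism Spoly n -> B}) :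
    frobenius_lifts n p -> p%:R * p%:R = 0 :> B -> th (detX n) = 0 ->
  exists H : 'I_(nvars n) -> Spoly n,
    \det (\matrix_(i < n, j < n) (th 'X_(symvar i j) ^+ p
                                  + p%:R * th (H (symvar i j)))) = 0.
Proof.
case=> L [L_wd LD LM L1 LF] p2 thdet.
have thE a b : eqmod (p ^ 2)%N a b -> th a = th b.
  case=> g [h /(congr1 th)]; rewrite rmorphB rmorphD !rmorphM thdet rmorph_nat.
  by rewrite p2 !mul0r addr0 => /subr0_eq.
pose psi := th \o L.
have psiD a b : psi (a + b) = psi a + psi b.
  by rewrite /psi /= (thE _ _ (LD a b)) rmorphD.
have psiB : zmod_morphism psi.
  by move=> a b; apply/(canRL (addrK _)); rewrite -psiD subrK.
have psiM : monoid_morphism psi.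
  split; first by rewrite /psi /= (thE _ _ L1) rmorph1.
  by move=> a b; rewrite /psi /= (thE _ _ (LM a b)) rmorphM.
pose psiR : {rmorphism Spoly n -> B} :=
  HB.pack psi (GRing.isZmodMorphism.Build _ _ psi psiB)
              (GRing.isMonoidMorphism.Build _ _ psi psiM).
have psidet : psiR (detX n) = 0.
  rewrite -(rmorph0 psiR); apply/thE/L_wd.
  by exists 1, 0; rewrite subr0 mulr1 mulr0 addr0.
have /fin_all_exists[H HE] (v : 'I_(nvars n)) :
    exists h, psiR 'X_v = th 'X_v ^+ p + p%:R * th h.
  have [g [h /(congr1 th) E]] := LF 'X_v; exists h; move: E.
  rewrite rmorphB rmorphXn rmorphD !rmorphM thdet rmorph_nat mul0r add0r.
  by move/(canRL (subrK _)) => E; rewrite addrC; exact: E.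
exists H; rewrite -[RHS]psidet /detX -det_map_mx; congr (\det _).
by apply/matrixP => i j; rewrite !mxE HE.
Qed.

(** Since [q^2 = 0], a unipotent column operation clears the lower left block without changing [P],
    and [det (1 + qY)] is a unit with inverse [det (1 - qY)]. *)
Lemma det_block_sqr0 (B : comNzRingType) (q : B) k r
    (P : 'M_k) (Q : 'M_(k, r)) (R : 'M_(r, k)) (Y : 'M_r) : q * q = 0 ->
  \det (block_mx P (q *: Q) (q *: R) (1%:M + q *: Y)) = 0 -> \det P = 0.
Proof.
move=> q2 /(congr1 (fun d => d * \det (block_mx 1%:M 0 (- (q *: R)) 1%:M))).
rewrite mul0r -det_mulmx mulmx_block !mulmx1 !mulmx0 !add0r.
rewrite !mulmxN mulmxDl mul1mx -!scalemxAl -!scalemxAr !scalerA q2 !scale0r.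
rewrite !addr0 subr0 subrr det_ublock => detPW.
have detW : \det (1%:M + q *: Y) * \det (1%:M - q *: Y) = 1.
  rewrite -det_mulmx mulmxDl mul1mx mulmxBr mulmx1 -scalemxAl -scalemxAr.
  by rewrite scalerA q2 scale0r subr0 subrK det1.
by rewrite -[LHS]mulr1 -detW mulrA detPW mul0r.
Qed.

(** * Specializations with a multigrading *)

Section WeightedSpecialization.
Variables (T : comNzRingType) (N k : nat).
Variables (t : 'I_N -> T) (w : 'I_N -> 'X_{1..k}).

Definition wspec : {mpoly int[N]} -> {mpoly T[k]} :=
  mmap intr (fun v => t v *: 'X_[w v]).

HB.instance Definition _ := GRing.RMorphism.on wspec.

Lemma wspecX v : wspec 'X_v = t v *: 'X_[w v].
Proof. by rewrite /wspec mmapX mmap1U. Qed.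

(** A monomial of [P] contributes only if its total weight is [p] times [w v0]. The alternatives say
    that any other variable kills the monomial, is sent to 1, or brings in an indeterminate absent
    from [w v0]; so [v0] occurs exactly [p] times in what remains. *)
Lemma mcoeff_wspec v0 p P :
    w v0 != 0%MM ->
    (forall v, v != v0 -> [\/ t v = 0, w v = 0%MM /\ t v = 1
                            | exists i, w v0 i = 0%N /\ w v i != 0%N]) ->
  exists c : int, (wspec P)@_(w v0 *+ p) = c%:~R * t v0 ^+ p.
Proof.
move=> w0 tw; rewrite /wspec /mmap raddf_sum /=.
apply: (big_ind (fun a => exists c : int, a = c%:~R * t v0 ^+ p)).
- by exists 0; rewrite mul0r.
- by move=> _ _ [c ->] [d ->]; exists (c + d); rewrite rmorphD mulrDl.
move=> m _; set c := P@_m.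
have -> : mmap1 (fun v => t v *: 'X_[w v]) m =
    (\prod_v t v ^+ m v) *: 'X_[(\sum_v w v *+ m v)%MM] :> {mpoly T[k]}.
  rewrite /mmap1 -mprodXnE -scaler_prod; apply: eq_bigr => v _.
  by rewrite exprZn.
rewrite mulrzl raddfMz /= mcoeffZ mcoeffX.
have [wE|_] := eqVneq; last by exists 0; rewrite mulr0 mul0rz mul0r.
have mv v : v != v0 -> m v != 0%N -> t v = 0 \/ w v = 0%MM /\ t v = 1.
  move=> /tw[tv|wt|[i [i0 iv]]] mvn0; [by left | by right |].
  have /eqP := congr1 (fun mu : 'X_{1..k} => mu i) wE.
  rewrite mulmnE i0 mnm_sumE (bigD1 v) //= mulmnE.
  by rewrite addn_eq0 muln_eq0 (negPf iv) (negPf mvn0).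
have [/existsP[v /and3P[vv0 mvn0 /eqP tv0]]|] :=
    boolP [exists v, [&& v != v0, m v != 0%N & t v == 0]].
  exists 0; rewrite mul0r (bigD1 v) //= tv0 expr0n (negPf mvn0).
  by rewrite !mul0r mul0rz.
rewrite negb_exists => /forallP mt.
have {mv mt}mv v : v != v0 -> m v != 0%N -> w v = 0%MM /\ t v = 1.
  move=> vv0 mvn0; have := mt v; rewrite vv0 mvn0 /= => /eqP tv.
  by have [] := mv v vv0 mvn0.
exists c; rewrite (bigD1 v0) //= big1 ?mulr1; last first.
  by move=> v vv0; have [->|/(mv v vv0)[_ ->]] := eqVneq (m v) 0%N; rewrite ?expr1n.
rewrite (_ : m v0 = p) ?mulrzl //.
have [i wi] : exists i, w v0 i != 0%N.
  apply/existsP; apply: contraNT w0; rewrite negb_exists => /forallP wi.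
  by apply/eqP/mnmP => i; rewrite mnm0E; have /negPn/eqP := wi i.
have /eqP := congr1 (fun mu : 'X_{1..k} => mu i) wE.
rewrite mulmnE mnm_sumE (bigD1 v0) //= big1 ?addn0; last first.
  move=> v vv0; rewrite mulmnE.
  by have [->|/(mv v vv0)[-> _]] := eqVneq (m v) 0%N; rewrite ?muln0 ?mnm0E.
by rewrite mulmnE eqn_pmul2l ?lt0n // => /eqP.
Qed.

End WeightedSpecialization.

(** * Symmetric matrices completed by an identity block *)

Section BlockSpecialization.
Variables (T : comNzRingType) (k r : nat) (m : 'I_k -> 'I_k -> T).
Hypothesis m_sym : forall a b, m a b = m b a.

Definition block_entry (ij : 'I_(k + r) * 'I_(k + r)) : T :=
  match split ij.1, split ij.2 with
  | inl a, inl b => m a b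
  | inr a, inr b => (a == b)%:R
  | _, _ => 0
  end.

Definition block_weight (ij : 'I_(k + r) * 'I_(k + r)) : 'X_{1..k} :=
  match split ij.1, split ij.2 with
  | inl a, inl b => (U_(a) + U_(b))%MM
  | _, _ => 0%MM
  end.

Definition block_spec : Spoly (k + r) -> {mpoly T[k]} :=
  wspec (fun v => block_entry (val (enum_val v)))
        (fun v => block_weight (val (enum_val v))).

HB.instance Definition _ := GRing.RMorphism.on block_spec.

Lemma block_entry_sort i j : block_entry (sortpair i j) = block_entry (i, j).
Proof.
rewrite /sortpair; case: ifP => // _; rewrite /block_entry /=.
by case: (split i) => a; case: (split j) => b //; rewrite eq_sym.
Qed.

Lemma block_weight_sort i j : block_weight (sortpair i j) = block_weight (i, j).
Proof.
rewrite /sortpair; case: ifP => // _; rewrite /block_weight /=.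
by case: (split i) => a; case: (split j) => b //; rewrite addmC.
Qed.

Lemma block_specX i j :
  block_spec 'X_(symvar i j) = block_entry (i, j) *: 'X_[block_weight (i, j)].
Proof.
by rewrite /block_spec wspecX val_enum_symvar block_entry_sort block_weight_sort.
Qed.

Lemma block_specX_ul a b :
  block_spec 'X_(symvar (lshift r a) (lshift r b)) = m a b *: 'X_[U_(a) + U_(b)].
Proof.
by rewrite block_specX /block_entry /block_weight /= !(unsplitK (inl _)).
Qed.

Lemma block_specX_ur a b :
  block_spec 'X_(symvar (lshift r a) (rshift k b)) = 0.
Proof.
rewrite block_specX /block_entry /= (unsplitK (inl _)) (unsplitK (inr _)).
exact: scale0r.
Qed.

Lemma block_specX_dr a b :
  block_spec 'X_(symvar (rshift k a) (rshift k b)) = (a == b)%:R.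
Proof.
rewrite block_specX /block_entry /block_weight /= !(unsplitK (inr _)).
by rewrite mpolyX0 -mul_mpolyC mulr1 rmorph_nat.
Qed.

Lemma block_spec_det :
  block_spec (detX (k + r)) =
  \det (\matrix_(a < k, b < k) (m a b *: 'X_[U_(a) + U_(b)]) : 'M[{mpoly T[k]}]_k).
Proof.
rewrite /detX -det_map_mx; set M := map_mx _ _; rewrite -[M]submxK.
have -> : ursubmx M = 0.
  by apply/matrixP => a b; rewrite !mxE; exact: block_specX_ur.
have -> : drsubmx M = 1%:M.
  by apply/matrixP => a b; rewrite !mxE; exact: block_specX_dr.
rewrite det_lblock det1 mulr1; congr (\det _).
by apply/matrixP => a b; rewrite !mxE; exact: block_specX_ul.
Qed.

(** Only the variables at [(a, a)], [(b, b)] and [(a, b)] have nonzero weight supported on [a] and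
    [b]. For distinct [a], [b] the product of the first two has the weight of the square of the
    third; the vanishing diagonal entries exclude this. *)
Lemma mcoeff_block_spec p (a b : 'I_k) P :
    a = b \/ m a a = 0 /\ m b b = 0 ->
  exists c : int,
    (block_spec P)@_((U_(a) + U_(b)) *+ p) = c%:~R * m a b ^+ p.
Proof.
move=> ab; pose v0 := symvar (lshift r a) (lshift r b).
have w0 : block_weight (val (enum_val v0)) = (U_(a) + U_(b))%MM.
  rewrite val_enum_symvar block_weight_sort /block_weight /=.
  by rewrite !(unsplitK (inl _)).
have t0 : block_entry (val (enum_val v0)) = m a b.
  rewrite val_enum_symvar block_entry_sort /block_entry /=.
  by rewrite !(unsplitK (inl _)).
rewrite -w0 -t0; apply: (@mcoeff_wspec _ _ _ _ _ v0).
  by rewrite w0 -mdeg_eq0 mdegD !mdeg1.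
move=> v; have [i [j ->]] := symvar_surj v.
rewrite w0 val_enum_symvar block_entry_sort block_weight_sort.
rewrite /block_entry /block_weight /=.
case: (splitP i) => c /= ci; case: (splitP j) => d /= dj; last 3 first.
- by constructor 1.
- by constructor 1.
- by move=> _; case: eqP => _; [constructor 2 | constructor 1].
have {ci}-> : i = lshift r c by apply: val_inj.
have {dj}-> : j = lshift r d by apply: val_inj.
move=> neq.
have [/andP[ca cb]|cab] := boolP ((c != a) && (c != b)).
  constructor 3; exists c.
  by rewrite !mnmDE !mnm1E ![_ == c]eq_sym (negPf ca) (negPf cb) eqxx.
have [/andP[da db]|dab] := boolP ((d != a) && (d != b)).
  constructor 3; exists d.
  by rewrite !mnmDE !mnm1E ![_ == d]eq_sym (negPf da) (negPf db) eqxx addn1.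
constructor 1; move: neq; rewrite /v0.
move: cab dab; rewrite !negb_and !negbK => /orP[] /eqP-> /orP[] /eqP->.
- by case: ab => [->|[]] //; rewrite eqxx.
- by rewrite eqxx.
- by rewrite symvarC eqxx.
by case: ab => [->|[]] //; rewrite eqxx.
Qed.

(** Apart from the identity, the blocks outside the upper left one are multiples of [p] in the
    lifted matrix, so [det_block_sqr0] reduces its determinant to size [k]. *)
Lemma block_obstruction p :
    frobenius_lifts (k + r) p -> (0 < p)%N -> p%:R * p%:R = 0 :> T ->
    \det (\matrix_(a < k, b < k) (m a b *: 'X_[U_(a) + U_(b)])
            : 'M[{mpoly T[k]}]_k) = 0 ->
  exists H : 'I_k -> 'I_k -> {mpoly T[k]},
  [/\ forall a b, H a b = H b a,
      \det (\matrix_(a < k, b < k)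
        ((m a b *: 'X_[U_(a) + U_(b)]) ^+ p + p%:R * H a b)) = 0
    & forall a b, a = b \/ m a a = 0 /\ m b b = 0 ->
      exists c : int, (H a b)@_((U_(a) + U_(b)) *+ p) = c%:~R * m a b ^+ p].
Proof.
move=> lift p_gt0 p2 det0.
have p2' : p%:R * p%:R = 0 :> {mpoly T[k]}.
  by rewrite -!(rmorph_nat (@mpolyC _ _)) -rmorphM p2 rmorph0.
have [|H HE] := lift_specialize (th := block_spec) lift p2'.
  exact: etrans block_spec_det det0.
have {}HE : \det (\matrix_(i < k + r, j < k + r) (block_spec 'X_(symvar i j) ^+ p
    + p%:R * block_spec (H (symvar i j)))) = 0 by exact: HE.
exists (fun a b => block_spec (H (symvar (lshift r a) (lshift r b)))).
split; first by move=> a b; rewrite symvarC.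
  move: HE; set M := (X in \det X).
  rewrite -[M]submxK.
  pose h i j := block_spec (H (symvar i j)).
  rewrite (_ : ursubmx M = p%:R *: \matrix_(a, b) h (lshift r a) (rshift k b)); last first.
    apply/matrixP => a b; rewrite !mxE block_specX_ur.
    by rewrite expr0n (gtn_eqF p_gt0) add0r.
  rewrite (_ : dlsubmx M = p%:R *: \matrix_(a, b) h (rshift k a) (lshift r b)); last first.
    apply/matrixP => a b; rewrite !mxE symvarC block_specX_ur symvarC.
    by rewrite expr0n (gtn_eqF p_gt0) add0r.
  rewrite (_ : drsubmx M = 1%:M + p%:R *: \matrix_(a, b) h (rshift k a) (rshift k b)); last first.
    apply/matrixP => a b; rewrite !mxE block_specX_dr.
    by case: eqP => _; rewrite ?expr1n // expr0n (gtn_eqF p_gt0).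
  move/(det_block_sqr0 p2') => <-; congr (\det _).
  by apply/matrixP => a b; rewrite !mxE block_specX_ul.
by move=> a b; exact: mcoeff_block_spec.
Qed.

End BlockSpecialization.

(** * The obstructions *)

Lemma natr_sqr_Zp p : (1 < p)%N -> p%:R * p%:R = 0 :> {poly 'Z_(p ^ 2)}.
Proof.
move=> p_gt1; rewrite -natrM mulnn -polyC_natr pchar_Zp //.
by rewrite -[1%N](exp1n 2) ltn_exp2r.
Qed.

Lemma mcoeffCMX (T : comNzRingType) k (c : T) (P : {mpoly T[k]}) mu nu tau :
  (nu + mu)%MM = tau -> (c%:MP * ('X_[nu] * P))@_tau = c * P@_mu.
Proof. by move=> <-; rewrite mcoeffCM ['X_[nu] * P]mulrC mcoeffMX. Qed.

Lemma mcoeff_natMX (T : comNzRingType) k n (P : {mpoly T[k]}) mu nu tau :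
  (nu + mu)%MM = tau -> (n%:R * ('X_[nu] * P))@_tau = n%:R * P@_mu.
Proof. by rewrite -(rmorph_nat (@mpolyC _ _)); exact: mcoeffCMX. Qed.

Lemma coef1_XaddC_exp (T : comNzRingType) p : (('X + 1 : {poly T}) ^+ p)`_1 = p%:R.
Proof.
have := coef_deriv (('X + 1 : {poly T}) ^+ p) 0.
rewrite mulr1n => <-; rewrite deriv_exp derivD derivX derivC addr0 ?(mul1r, mulr1).
by rewrite coefMn -horner_coef0 !hornerE expr1n.
Qed.

(** The part free of [h] is [(s + 1)^2 - 1 - s^2 = 2s] times [(l0 l1 l2)^2]. The terms in [h] are
    the diagonal cofactors reduced modulo 2; the off-diagonal ones already carry a factor 4. *)
Lemma sdet3_first_order (R : comNzRingType) (l0 l1 l2 s : R)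
    (h : nat -> nat -> R) : 4%:R = 0 :> R ->
  sdet3 (l0 * l0 + 2%:R * h 0 0) (l1 * l1 + 2%:R * h 1 1)
        ((s + 1) ^+ 2 * l2 * l2 + 2%:R * h 2 2)
        (l1 * l2 + 2%:R * h 1 2) (s * l0 * l2 + 2%:R * h 0 2)
        (2%:R * h 0 1)
  = 2%:R * (s * (l0 * l1 * l2) ^+ 2 + s ^+ 2 * ((l1 * l2) ^+ 2 * h 0 0)
            + (l0 * l2) ^+ 2 * h 1 1 + (l0 * l1) ^+ 2 * h 2 2).
Proof.
move=> R4.
have expand (a b c f g A B C F G H : R) :
    sdet3 (a + 2%:R * A) (b + 2%:R * B) (c + 2%:R * C)
          (f + 2%:R * F) (g + 2%:R * G) (2%:R * H)
    = a * b * c - a * f ^+ 2 - b * g ^+ 2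
      + 2%:R * (A * (b * c - f ^+ 2) + B * (a * c - g ^+ 2) + C * a * b)
      + 4%:R * (A * B * c + A * b * C + a * B * C + 2%:R * A * B * C
                + (f + 2%:R * F) * (g + 2%:R * G) * H
                - (a + 2%:R * A) * (f * F + F ^+ 2)
                - (b + 2%:R * B) * (g * G + G ^+ 2) - (c + 2%:R * C) * H ^+ 2).
  by rewrite /sdet3; ring.
rewrite expand R4 mul0r addr0 -[LHS]subr0.
(* The subtracted zero, turned into a multiple of 4, accounts for the summands [2s] of the first two
   cofactors. *)
rewrite -[X in _ - X](mul0r (s * (l1 ^+ 2 * l2 ^+ 2 * h 0 0 + l0 ^+ 2 * l2 ^+ 2 * h 1 1))).
by rewrite -R4; ring.
Qed.

Definition sdet4 (R : comNzRingType) (d0 d1 d2 d3 a b c d e f : R) : R :=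
    d0 * (d1 * (d2 * d3 - f ^+ 2) - d * (d * d3 - f * e) + e * (d * f - d2 * e))
  - a * (a * (d2 * d3 - f ^+ 2) - d * (b * d3 - f * c) + e * (b * f - d2 * c))
  + b * (a * (d * d3 - f * e) - d1 * (b * d3 - f * c) + e * (b * e - d * c))
  - c * (a * (d * f - d2 * e) - d1 * (b * f - d2 * c) + d * (b * e - d * c)).

Lemma det_sym4 (R : comNzRingType) (F : nat -> nat -> R) :
  (forall i j, F i j = F j i) ->
  \det (\matrix_(i < 4, j < 4) F i j) =
  sdet4 (F 0 0) (F 1 1) (F 2 2) (F 3 3)
        (F 0 1) (F 0 2) (F 0 3) (F 1 2) (F 1 3) (F 2 3).
Proof.
move=> Fsym; rewrite det_matrix4 (Fsym 1 0) (Fsym 2 0) (Fsym 3 0).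
by rewrite (Fsym 2 1) (Fsym 3 1) (Fsym 3 2) /sdet4; ring.
Qed.

(** For [h = 0] the determinant is [(l0 l1 l2 l3)^2] times [(x+1+z)(x+1-z)(x-1+z)(x-1-z)]. Only the
    second factor vanishes at [z = x + 1]; its first-order term gives [8 q c x (x + 1)]. The rest
    are the cofactors at [z = x + 1]. *)
Lemma sdet4_first_order (R : comNzRingType) (q l0 l1 l2 l3 x z c : R)
    (h : nat -> nat -> R) :
    q ^+ 2 = 0 -> z = x + 1 + q * c ->
  sdet4 (q * h 0 0) (q * h 1 1) (q * h 2 2) (q * h 3 3)
        (x * l0 * l1 + q * h 0 1) (l0 * l2 + q * h 0 2)
        (z * l0 * l3 + q * h 0 3) (z * l1 * l2 + q * h 1 2)
        (l1 * l3 + q * h 1 3) (x * l2 * l3 + q * h 2 3)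
  = q * (x * (x + 1)) *
    (8%:R * c * (l0 * l1 * l2 * l3) ^+ 2
     + 2%:R * ((l0 * l1 * l2) ^+ 2 * h 3 3 + (l0 * l1 * l3) ^+ 2 * h 2 2
               + (l0 * l2 * l3) ^+ 2 * h 1 1 + (l1 * l2 * l3) ^+ 2 * h 0 0)
     - 4%:R * (l0 * l1 * l2 * l3) *
         (l2 * l3 * h 0 1 + l0 * l1 * h 2 3 + l1 * l3 * h 0 2 + l0 * l2 * h 1 3)
     + 4%:R * (l0 * l1 * l2 * l3) * (l1 * l2 * h 0 3 + l0 * l3 * h 1 2)).
Proof. by move=> q2 ->; rewrite /sdet4; ring: q2. Qed.

(** The Gram matrix of [(1, 0)], [(0, 1)] and [(s, 1)], hence of determinant zero; its entrywise
    square has determinant [2 s^2]. *)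
Definition entry3 (T : comNzRingType) (s : T) (i j : nat) : T :=
  match i, j with
  | 0, 0 | 1, 1 | 1, 2 | 2, 1 => 1
  | 0, 2 | 2, 0 => s
  | 2, 2 => s ^+ 2 + 1
  | _, _ => 0
  end.

Lemma entry3C (T : comNzRingType) (s : T) i j : entry3 s i j = entry3 s j i.
Proof. by case: i j => [|[|[|i]]] [|[|[|j]]]. Qed.

Lemma scale_mpolyXU (T : comNzRingType) k (c : T) (a b : 'I_k.+1) :
  c *: 'X_[U_(a) + U_(b)] = c%:MP * 'X_(inord a) * 'X_(inord b) :> {mpoly T[k.+1]}.
Proof. by rewrite -mul_mpolyC mpolyXD mulrA !inord_val. Qed.

Lemma not_frobenius_lifts2 r : ~ frobenius_lifts (3 + r) 2.
Proof.
pose T := {poly 'Z_(2 ^ 2)}; pose s : T := 'X.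
have p2 : 2%:R * 2%:R = 0 :> T := natr_sqr_Zp (isT : 1 < 2)%N.
pose l i : {mpoly T[3]} := 'X_(inord i).
move=> /(block_obstruction (fun a b : 'I_3 => entry3C s a b)) /(_ isT p2) [].
  rewrite (_ : \matrix_(a, b) _ =
    \matrix_(a < 3, b < 3) ((entry3 s a b)%:MP * l a * l b)); last first.
    by apply/matrixP => a b; rewrite !mxE scale_mpolyXU.
  rewrite (det_sym3 (F := fun i j => (entry3 s i j)%:MP * l i * l j)) /=.
    by rewrite /sdet3 mpolyC0 mpolyC1 rmorphD rmorph1 rmorphXn /=; ring.
  by move=> i j; rewrite entry3C mulrAC.
move=> H [Hsym detH Hcoef].
pose h i j := H (inord i) (inord j).
have h_sym i j : h i j = h j i by exact: Hsym.
have R4 : 4%:R = 0 :> {mpoly T[3]}.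
  by rewrite -(rmorph_nat (@mpolyC _ _)) (natrM _ 2 2) p2 rmorph0.
move: detH; rewrite (_ : \matrix_(a, b) _ =
    \matrix_(a < 3, b < 3) ((entry3 s a b ^+ 2)%:MP * l a ^+ 2 * l b ^+ 2
                            + 2%:R * h a b)); last first.
  apply/matrixP => a b; rewrite !mxE scale_mpolyXU !exprMn -rmorphXn.
  by rewrite /h /l !inord_val.
rewrite (det_sym3 (F := fun i j => (entry3 s i j ^+ 2)%:MP * l i ^+ 2 * l j ^+ 2
                            + 2%:R * h i j)) /=; last first.
  by move=> i j; rewrite entry3C h_sym mulrAC.
(* The expansion is applied with [l_i^2] and [s^2] in place of [l_i] and [s]. *)
set S := s ^+ 2; rewrite !expr1n !mpolyC1 !mul1r expr0n mpolyC0 !mul0r add0r.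
rewrite rmorphXn rmorphD rmorph1 (sdet3_first_order _ _ _ _ _ R4).
pose e i : 'X_{1..3} := U_(inord i)%MM.
pose tau : 'X_{1..3} := ((e 0%N + e 1%N + e 2%N) *+ 4)%MM.
have lX i : l i = 'X_[e i] by [].
have -> : S%:MP * (l 0 ^+ 2 * l 1 ^+ 2 * l 2 ^+ 2) ^+ 2 = S%:MP * ('X_[tau] * 1).
  by rewrite -mpolyXn !mpolyXD -!lX; ring.
have -> : (l 1 ^+ 2 * l 2 ^+ 2) ^+ 2 = 'X_[(e 1%N + e 2%N) *+ 4].
  by rewrite -mpolyXn !mpolyXD -!lX; ring.
have -> : (l 0 ^+ 2 * l 2 ^+ 2) ^+ 2 * h 1 1 = 1%:MP * ('X_[(e 0%N + e 2%N) *+ 4] * h 1 1).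
  by rewrite mpolyC1 -mpolyXn !mpolyXD -!lX; ring.
have -> : (l 0 ^+ 2 * l 1 ^+ 2) ^+ 2 * h 2 2 = 1%:MP * ('X_[(e 0%N + e 1%N) *+ 4] * h 2 2).
  by rewrite mpolyC1 -mpolyXn !mpolyXD -!lX; ring.
move/(congr1 (mcoeff tau)); rewrite -(rmorph_nat (@mpolyC _ _)) -rmorphXn /=.
rewrite mcoeff0 mcoeffCM !mcoeffD.
rewrite (@mcoeffCMX _ _ _ 1 0%MM) ?addm0 //.
rewrite (@mcoeffCMX _ _ _ (h 0 0) ((e 0%N + e 0%N) *+ 2)%MM); last first.
  by apply/mnmP => i; rewrite !(mulmnE, mnmDE); lia.
rewrite (@mcoeffCMX _ _ _ (h 1 1) ((e 1%N + e 1%N) *+ 2)%MM); last first.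
  by apply/mnmP => i; rewrite !(mulmnE, mnmDE); lia.
rewrite (@mcoeffCMX _ _ _ (h 2 2) ((e 2%N + e 2%N) *+ 2)%MM); last first.
  by apply/mnmP => i; rewrite !(mulmnE, mnmDE); lia.
have hcoef i : (i <= 2)%N -> exists c : int,
    (h i i)@_((e i + e i) *+ 2) = c%:~R * entry3 s i i ^+ 2.
  move=> i_le; have [c cE] := Hcoef (inord i) (inord i) (or_introl erefl).
  by exists c; rewrite cE inordK.
have [c0 ->] := hcoef 0%N isT; have [c1 ->] := hcoef 1%N isT.
have [c2 ->] := hcoef 2%N isT; rewrite /= !expr1n !mulr1 mul1r mcoeff1 eqxx mulr1.
(* At [s^2] the terms from [h] contribute only [4 c2], which is 0, so the coefficient is 2, nonzero
   modulo 4. *)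
move/(congr1 (fun P : {poly 'Z_(2 ^ 2)} => P`_2)).
have -> : 2%:R * (S + S ^+ 2 * c0%:~R + c1%:~R + 1 * (c2%:~R * (S + 1) ^+ 2)) =
  2%:R * 'X^2 + (2%:R * 2%:R) * c2%:~R * S + (2%:R * (c0%:~R + c2%:~R)) * 'X^4
    + 2%:R * (c1%:~R + c2%:~R) :> T.
  by rewrite /S /s; ring.
rewrite p2 !mul0r addr0.
have -> : 2%:R * (c1%:~R + c2%:~R) = (2%:R * (c1 + c2)%:~R)%:P :> T.
  by rewrite rmorphM rmorph_nat rmorph_int rmorphD.
rewrite !coefD !coefMXn coefC coef0 /= !addr0 -polyC_natr coefC /=.
by move/eqP.
Qed.

(* With [s = 'X] the pairwise products [s^2, 1, (s + 1)^2] of opposite entries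
   have square roots summing up to zero, with suitable signs; this makes the
   determinant vanish. *)
Definition entry4 (T : comNzRingType) (s : T) (i j : nat) : T :=
  match i, j with
  | 0, 1 | 1, 0 | 2, 3 | 3, 2 => s
  | 0, 2 | 2, 0 | 1, 3 | 3, 1 => 1
  | 0, 3 | 3, 0 | 1, 2 | 2, 1 => s + 1
  | _, _ => 0
  end.

Lemma entry4C (T : comNzRingType) (s : T) i j : entry4 s i j = entry4 s j i.
Proof. by case: i j => [|[|[|[|i]]]] [|[|[|[|j]]]]. Qed.

Lemma entry4_diag (T : comNzRingType) (s : T) i : entry4 s i i = 0.
Proof. by case: i => [|[|[|[|i]]]]. Qed.

Lemma not_frobenius_lifts4 p r :
  prime p -> odd p -> ~ frobenius_lifts (4 + r) p.
Proof.
move=> p_pr p_odd; have p_gt0 := prime_gt0 p_pr; have p_gt1 := prime_gt1 p_pr.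
pose T := {poly 'Z_(p ^ 2)}; pose s : T := 'X.
have p2 : p%:R * p%:R = 0 :> T := natr_sqr_Zp p_gt1.
pose l i : {mpoly T[4]} := 'X_(inord i).
move=> /(block_obstruction (fun a b : 'I_4 => entry4C s a b)) /(_ p_gt0 p2) [].
  rewrite (_ : \matrix_(a, b) _ =
    \matrix_(a < 4, b < 4) ((entry4 s a b)%:MP * l a * l b)); last first.
    by apply/matrixP => a b; rewrite !mxE scale_mpolyXU.
  rewrite (det_sym4 (F := fun i j => (entry4 s i j)%:MP * l i * l j)) /=.
    by rewrite /sdet4 mpolyC0 mpolyC1 rmorphD rmorph1 /=; ring.
  by move=> i j; rewrite entry4C mulrAC.
move=> H [Hsym detH Hcoef].
have [h hE] : {h | forall i j, h i j = H (inord i) (inord j)} by eexists.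
have h_sym i j : h i j = h j i by rewrite !hE Hsym.
have q2 : p%:R ^+ 2 = 0 :> {mpoly T[4]}.
  by rewrite expr2 -!(rmorph_nat (@mpolyC _ _)) -rmorphM p2 rmorph0.
have [w wE] := exprD_prime s 1 p_pr; rewrite expr1n in wE.
move: detH; rewrite (_ : \matrix_(a, b) _ =
    \matrix_(a < 4, b < 4) ((entry4 s a b ^+ p)%:MP * l a ^+ p * l b ^+ p
                            + p%:R * h a b)); last first.
  apply/matrixP => a b; rewrite !mxE scale_mpolyXU !exprMn -rmorphXn.
  by rewrite hE /l !inord_val.
rewrite (det_sym4 (F := fun i j => (entry4 s i j ^+ p)%:MP * l i ^+ p * l j ^+ p
                            + p%:R * h i j)) /=; last first.
  by move=> i j; rewrite h_sym entry4C mulrAC.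
rewrite !expr1n !mpolyC1 !mul1r expr0n gtn_eqF // mpolyC0 !mul0r !add0r.
(* Here [x = s^p] and [z = (s + 1)^p], so the defect [c] is the quotient [w] of
   [(s + 1)^p - s^p - 1] by [p]. *)
rewrite (sdet4_first_order _ _ _ _ _ q2 (c := w%:MP)); last first.
  by rewrite wE !rmorphD rmorphM rmorph1 rmorph_nat.
pose e i : 'X_{1..4} := U_(inord i)%MM.
(* [nu] and [tau] stay abstract, lest matching on monomials unfold them. *)
have [nu nuE] : {nu | forall i1 i2 i3 i4 i5 i6, nu i1 i2 i3 i4 i5 i6 =
    ((e i1 + e i2 + e i3 + e i4 + e i5 + e i6) *+ p)%MM :> 'X_{1..4}}.
  by exists (fun i1 i2 i3 i4 i5 i6 =>
               ((e i1 + e i2 + e i3 + e i4 + e i5 + e i6) *+ p)%MM).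
have [tau tauE] : {tau : 'X_{1..4} |
    tau = (nu 0%N 0%N 1%N 1%N 2%N 2%N + (e 3%N + e 3%N) *+ p)%MM} by eexists.
have nuX i1 i2 i3 i4 i5 i6 : 'X_[nu i1 i2 i3 i4 i5 i6] =
    l i1 ^+ p * l i2 ^+ p * l i3 ^+ p * l i4 ^+ p * l i5 ^+ p * l i6 ^+ p.
  by rewrite nuE -mpolyXn !mpolyXD !exprMn.
have tauX : 'X_[tau] = (l 0 ^+ p * l 1 ^+ p * l 2 ^+ p * l 3 ^+ p) ^+ 2.
  by rewrite tauE mpolyXD nuX -mpolyXn mpolyXD exprMn -[mpolyX _ (e 3)]/(l 3); ring.
set lhs := (X in X = 0 -> _).
(* The indices of each [nu] complete those of the accompanying [h] to every index taken twice, so at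
   [tau] each [h i j] is read in degree [(e i + e j) *+ p]. *)
have -> : lhs = (p%:R * (s ^+ p * (s ^+ p + 1)))%:MP *
    ((8%:R * w)%:MP * ('X_[tau] * 1)
    + 2%:R * ('X_[nu 1%N 1%N 2%N 2%N 3%N 3%N] * h 0 0)
    + 2%:R * ('X_[nu 0%N 0%N 2%N 2%N 3%N 3%N] * h 1 1)
    + 2%:R * ('X_[nu 0%N 0%N 1%N 1%N 3%N 3%N] * h 2 2)
    + 2%:R * ('X_[nu 0%N 0%N 1%N 1%N 2%N 2%N] * h 3 3)
    - 4%:R * ('X_[nu 0%N 1%N 2%N 2%N 3%N 3%N] * h 0 1)
    - 4%:R * ('X_[nu 0%N 0%N 1%N 1%N 2%N 3%N] * h 2 3)
    - 4%:R * ('X_[nu 0%N 1%N 1%N 2%N 3%N 3%N] * h 0 2)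
    - 4%:R * ('X_[nu 0%N 0%N 1%N 2%N 2%N 3%N] * h 1 3)
    + 4%:R * ('X_[nu 0%N 1%N 1%N 2%N 2%N 3%N] * h 0 3)
    + 4%:R * ('X_[nu 0%N 0%N 1%N 2%N 3%N 3%N] * h 1 2)).
  rewrite /lhs tauX !nuX; set lam := (p%:R * _)%:MP.
  have -> : lam = p%:R * ((s ^+ p)%:MP * ((s ^+ p)%:MP + 1)).
    by rewrite /lam !rmorphM rmorphD rmorph_nat rmorph1.
  have -> : (8%:R * w)%:MP = 8%:R * w%:MP :> {mpoly T[4]}.
    by rewrite rmorphM rmorph_nat.
  by ring.
move/(congr1 (mcoeff tau)); rewrite mcoeff0 mcoeffCM !(mcoeffD, mcoeffN).
rewrite (@mcoeffCMX _ _ _ 1 0%MM) ?addm0 // mcoeff1 eqxx mulr1.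
rewrite (@mcoeff_natMX _ _ _ (h 0 0) ((e 0%N + e 0%N) *+ p)%MM); last first.
  by apply/mnmP => i; rewrite tauE !nuE !(mulmnE, mnmDE); lia.
rewrite (@mcoeff_natMX _ _ _ (h 1 1) ((e 1%N + e 1%N) *+ p)%MM); last first.
  by apply/mnmP => i; rewrite tauE !nuE !(mulmnE, mnmDE); lia.
rewrite (@mcoeff_natMX _ _ _ (h 2 2) ((e 2%N + e 2%N) *+ p)%MM); last first.
  by apply/mnmP => i; rewrite tauE !nuE !(mulmnE, mnmDE); lia.
rewrite (@mcoeff_natMX _ _ _ (h 3 3) ((e 3%N + e 3%N) *+ p)%MM); last first.
  by apply/mnmP => i; rewrite tauE !nuE !(mulmnE, mnmDE); lia.
rewrite (@mcoeff_natMX _ _ _ (h 0 1) ((e 0%N + e 1%N) *+ p)%MM); last first.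
  by apply/mnmP => i; rewrite tauE !nuE !(mulmnE, mnmDE); lia.
rewrite (@mcoeff_natMX _ _ _ (h 2 3) ((e 2%N + e 3%N) *+ p)%MM); last first.
  by apply/mnmP => i; rewrite tauE !nuE !(mulmnE, mnmDE); lia.
rewrite (@mcoeff_natMX _ _ _ (h 0 2) ((e 0%N + e 2%N) *+ p)%MM); last first.
  by apply/mnmP => i; rewrite tauE !nuE !(mulmnE, mnmDE); lia.
rewrite (@mcoeff_natMX _ _ _ (h 1 3) ((e 1%N + e 3%N) *+ p)%MM); last first.
  by apply/mnmP => i; rewrite tauE !nuE !(mulmnE, mnmDE); lia.
rewrite (@mcoeff_natMX _ _ _ (h 0 3) ((e 0%N + e 3%N) *+ p)%MM); last first.
  by apply/mnmP => i; rewrite tauE !nuE !(mulmnE, mnmDE); lia.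
rewrite (@mcoeff_natMX _ _ _ (h 1 2) ((e 1%N + e 2%N) *+ p)%MM); last first.
  by apply/mnmP => i; rewrite tauE !nuE !(mulmnE, mnmDE); lia.
have hcoef i j : (i <= 3)%N -> (j <= 3)%N -> exists c : int,
    (h i j)@_((e i + e j) *+ p) = c%:~R * entry4 s i j ^+ p.
  move=> i_le j_le; have [|c cE] := Hcoef (inord i) (inord j).
    by right; rewrite !entry4_diag.
  by exists c; rewrite hE cE !inordK.
have [c00 ->] := hcoef 0%N 0%N isT isT.
have [c11 ->] := hcoef 1%N 1%N isT isT.
have [c22 ->] := hcoef 2%N 2%N isT isT.
have [c33 ->] := hcoef 3%N 3%N isT isT.
have [c01 ->] := hcoef 0%N 1%N isT isT.
have [c23 ->] := hcoef 2%N 3%N isT isT.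
have [c02 ->] := hcoef 0%N 2%N isT isT.
have [c13 ->] := hcoef 1%N 3%N isT isT.
have [c03 ->] := hcoef 0%N 3%N isT isT.
have [c12 ->] := hcoef 1%N 2%N isT isT.
rewrite /= !expr1n expr0n gtn_eqF //= !mulr0 !addr0 wE.
pose K0 : T := (- c02 - c13 + c03 + c12)%:~R.
pose K1 : T := (- c01 - c23 + c03 + c12)%:~R.
set P := (X in X = 0 -> _).
have -> : P = 'X^p * (8%:R * (p%:R * w) + 'X^p * (8%:R * (p%:R * w)
    + 4%:R * p%:R * (K1 * 'X^p + K0 + K1)) + 4%:R * p%:R * K0).
  rewrite /P /K0 /K1 !(rmorphB, rmorphD, rmorphN) /s /=.
  by ring: p2.
(* Apart from the terms in [w], only powers of [s^p] occur. The coefficient at [s^(p+1)] is thus 8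
   times that of [s] in [p w], namely [8p], which is nonzero modulo [p^2] for odd [p]. *)
move/(congr1 (fun P : {poly 'Z_(p ^ 2)} => P`_p.+1)).
rewrite coefXnM ltnNge leqnSn /= subSnn !coefD coefXnM p_gt1 addr0 coef0.
have -> : 4%:R * p%:R * K0 =
    (4%:R * p%:R * (- c02 - c13 + c03 + c12)%:~R)%:P.
  by rewrite !rmorphM !rmorph_nat rmorph_int.
have pw1 : (p%:R * w)`_1 = p%:R.
  rewrite -[in RHS](coef1_XaddC_exp _ p) -/s wE !coefD coefXn coefC.
  by rewrite ltn_eqF // !add0r.
rewrite coefC addr0 -polyC_natr coefCM pw1 -natrM => /(congr1 val) /=.
have p2_gt1 : (1 < p ^ 2)%N by rewrite -[1%N](exp1n 2) ltn_exp2r.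
rewrite val_Zp_nat // => /eqP; rewrite -/(dvdn _ _) expnS expn1 dvdn_pmul2r //.
rewrite (_ : 8 = 2 ^ 3)%N // Euclid_dvdX // => /andP[p_dvd2 _].
by move: p_odd; rewrite (eqP (_ : p == 2)) // -dvdn_prime2.
Qed.

Theorem theorem8p5 :
  [/\ (forall p : nat, prime p -> odd p -> frobenius_lifts 3 p),
      (forall n : nat, (3 <= n)%N -> ~ frobenius_lifts n 2)
    & (forall n p : nat, (4 <= n)%N -> prime p -> odd p -> ~ frobenius_lifts n p)].
Proof.
split; first exact: frobenius_lifts3.
  by move=> n /subnKC <-; exact: not_frobenius_lifts2.
by move=> n p /subnKC <-; exact: not_frobenius_lifts4.
Qed.
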